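(* Let $\omega$ be a free ultrafilter on $\mathbb{N}$ and let $\mathcal{M}$ be a $\mathrm{II}_1$ factor. If an automorphism of $\mathcal{M}^\omega$ is approximately inner, then it is $\aleph_0$-locally inner.
   Context: A $\mathrm{II}_1$ factor (no cardinality or separability assumption) has a unique tracial state $\tau$; set $\|x\|_2=\sqrt{\tau(x^*x)}$. Automorphisms are *-automorphisms. Tracial ultrapower: $\ell^\infty(\mathcal{M})$ is the algebra of norm-bounded sequences in $\mathcal{M}$, $\mathcal{I}_\omega=\{(x_j)\in\ell^\infty(\mathcal{M}) : \lim_{j\to\omega}\|x_j\|_2=0\}$, and $\mathcal{M}^\omega=\ell^\infty(\mathcal{M})/\mathcal{I}_\omega$, which is a $\mathrm{II}_1$ factor. Let $\alpha$ be an automorphism of a $\mathrm{II}_1$ factor. Inner automorphisms are those of the form $\mathrm{Ad}(u):x\mapsto uxu^*$ with $u$ a unitary in the factor. $\alpha$ is $\aleph_0$-locally inner if for every set of at most $\aleph_0$ elements of the factor there is an inner automorphism agreeing with $\alpha$ on that set. $\alpha$ is approximately inner if for every finite set $\{x_k\}$ of elements and every $\varepsilon>0$ there is a unitary $u$ in the factor with $\max_k\|\alpha(x_k)-ux_ku^*\|_2<\varepsilon$. *)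

(* Defs.v *)
From HB Require Import structures.
From mathcomp Require Import all_boot all_order all_algebra.
From mathcomp Require Import generic_quotient ring_quotient sesquilinear.
From mathcomp Require Import complex.
From mathcomp Require Import boolp classical_sets functions cardinality filter.
From mathcomp Require Import reals topology normedtype.
From mathcomp Require Import ring lra.

Set Implicit Arguments.
Unset Strict Implicit.
Unset Printing Implicit Defensive.
Import Order.TTheory GRing.Theory Num.Theory.
Import numFieldNormedType.Exports.
Local Open Scope classical_set_scope.
Local Open Scope complex_scope.
Local Open Scope quotient_scope.
Local Open Scope ring_scope.

HB.mixin Record hasInner (R : realType) H of CompleteNormedModule R[i] H := {
  inner : {dot H for @Num.conj R[i]};
  innerE : forall v : H, inner v v = `|v| ^+ 2
}.
#[short(type="hilbertType")]
HB.structure Definition Hilbert (R : realType) :=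
  {H of CompleteNormedModule R[i] H & hasInner R H}.

HB.mixin Record Algebra_isStarAlgebra (R : realType) A
    of GRing.Algebra R[i] A := {
  star : A -> A;
  starK : involutive star;
  starD : {morph star : x y / x + y};
  starM : forall x y : A, star (x * y) = star y * star x;
  starZ : forall (a : R[i]) (x : A), star (a *: x) = Num.conj a *: star x
}.
#[short(type="starAlgType")]
HB.structure Definition StarAlgebra (R : realType) :=
  {A of GRing.Algebra R[i] A & Algebra_isStarAlgebra R A}.

Section StarAlgebraDefs.
Variables (R : realType) (A : starAlgType R).

Lemma starB : {morph @star R A : x y / x - y}.
Proof.
by move=> x y; apply/eqP; rewrite -subr_eq0 opprB addrA -starD subrK subrr.
Qed.

Definition is_unitary (u : A) := star u * u = 1 /\ u * star u = 1.

Definition is_projection (p : A) := p * p = p /\ star p = p.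

Definition abelian_projection (p : A) :=
  is_projection p /\
  forall x y : A, (p * x * p) * (p * y * p) = (p * y * p) * (p * x * p).

Definition Ad (u x : A) := u * x * star u.

Definition star_automorphism (alpha : {lrmorphism A -> A}) :=
  bijective alpha /\ forall x, alpha (star x) = star (alpha x).

Definition aleph0_locally_inner (alpha : A -> A) :=
  forall S : set A, countable S ->
    exists2 u : A, is_unitary u & forall x, S x -> alpha x = Ad u x.

Variable tr : A -> R[i].

Definition norm2 (x : A) : R := Num.sqrt (complex.Re (tr (star x * x))).

Definition approximately_inner (alpha : A -> A) :=
  forall (S : set A) (e : R), finite_set S -> 0 < e ->
    exists2 u : A, is_unitary u &
      forall x, S x -> norm2 (alpha x - Ad u x) < e.

End StarAlgebraDefs.

Section Operators.
Variables (R : realType) (H : hilbertType R).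

Definition bounded_by (K : R) (T : H -> H) := forall v, `|T v| <= K%:C * `|v|.

Definition bounded_op (T : H -> H) := linear T /\ exists K, bounded_by K T.

Definition adjoint (T S : H -> H) := forall v w, inner (T v) w = inner v (S w).

Definition commutant (A : set (H -> H)) : set (H -> H) :=
  [set T | bounded_op T /\ forall S, A S -> T \o S = S \o T].

(* A von Neumann algebra on [H] is a self-adjoint set of bounded operators equal
   to its bicommutant; it is a factor if H != 0 and its center is scalar. *)
Record vn_factor := VNFactor {
  factor_set :> set (H -> H);
  factor_nontrivial : exists v : H, v != 0;
  factor_bounded : factor_set `<=` bounded_op;
  factor_adjoint :
    forall T, factor_set T -> exists2 S, factor_set S & adjoint T S;
  factor_bicommutant : commutant (commutant factor_set) = factor_set;
  factor_center : factor_set `&` commutant factor_set `<=`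
    [set (fun v => a *: v) | a in [set: R[i]]]
}.

Lemma commutant_linear (A : set (H -> H)) (a : R[i]) (S T : H -> H) :
  commutant A S -> commutant A T -> A `<=` bounded_op ->
  commutant A (a *: S + T).
Proof.
move=> [[Sl [KS KSP]] cS] [[Tl [KT KTP]] cT] Ab; split; first split.
- move=> b v w; rewrite !fctE Sl Tl; rewrite !scalerDr !scalerA addrACA.
  by rewrite [b * a]mulrC.
- exists (complex.Re `|a| * KS + KT) => v; rewrite !fctE.
  apply: (le_trans (ler_normD _ _)); rewrite rmorphD rmorphM /= mulrDl.
  rewrite lerD//; rewrite normrZ -mulrA.
  have -> : (complex.Re `|a|)%:C = `|a| by [].
  by rewrite ler_wpM2l.
- move=> U AU; apply/funext => v.
  have [Ul _] := Ab _ AU.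
  have := congr1 (@^~ v) (cS _ AU); have := congr1 (@^~ v) (cT _ AU).
  by rewrite /= !fctE => -> ->; rewrite Ul.
Qed.

Lemma commutant_comp (A : set (H -> H)) (S T : H -> H) :
  commutant A S -> commutant A T -> commutant A (S \o T).
Proof.
move=> [[Sl [KS KSP]] cS] [[Tl [KT KTP]] cT]; split; first split.
- by move=> b v w /=; rewrite Tl Sl.
- exists (`|KS| * KT) => v /=; apply: (le_trans (KSP _)).
  rewrite rmorphM /= -mulrA; apply: (@le_trans _ _ (`|KS|%:C * `|T v|)).
    by rewrite ler_wpM2r// lecR ler_norm.
  by rewrite ler_wpM2l// lecR.
- by move=> U AU; rewrite -compA cT// compA cS.
Qed.

Lemma commutant_id (A : set (H -> H)) : commutant A id.
Proof.
by split=> //; split=> //; exists 1 => v; rewrite mul1r.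
Qed.

Variable M : vn_factor.

Lemma factor_linear (a : R[i]) (S T : H -> H) :
  factor_set M S -> factor_set M T -> factor_set M (a *: S + T).
Proof.
rewrite -(factor_bicommutant M) => MS MT; apply: commutant_linear => //.
by move=> ? [].
Qed.

Lemma factor_comp (S T : H -> H) :
  factor_set M S -> factor_set M T -> factor_set M (S \o T).
Proof. by rewrite -(factor_bicommutant M); exact: commutant_comp. Qed.

Lemma factor_id : factor_set M id.
Proof. by rewrite -(factor_bicommutant M); exact: commutant_id. Qed.

Definition in_factor : {pred H -> H} := fun T => `[< factor_set M T >].

Lemma in_factorP T : reflect (factor_set M T) (T \in in_factor).
Proof. exact: asboolP. Qed.

Lemma in_factor_submod_closed : submod_closed in_factor.
Proof.
split=> [|a S T MS MT]; last first.
  by apply/in_factorP; apply: factor_linear; exact/in_factorP.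
apply/in_factorP; have := factor_linear (-1) factor_id factor_id.
by rewrite scaleN1r addNr.
Qed.

HB.instance Definition _ :=
  GRing.isSubmodClosed.Build R[i] (H -> H) in_factor in_factor_submod_closed.

(* The algebra of the elements of the factor [M]. *)
Definition elt := {T : H -> H | T \in in_factor}.

HB.instance Definition _ := SubChoice.on elt.
HB.instance Definition _ := [SubChoice_isSubLmodule of elt by <:].

Definition op (x : elt) : H -> H := val x.

Lemma opP x : factor_set M (op x).
Proof. by case: x => T MT; exact/in_factorP. Qed.

Lemma op_inj : injective op. Proof. exact: val_inj. Qed.

Lemma op_exists (T : H -> H) : factor_set M T -> exists x : elt, op x = T.
Proof. by move=> /in_factorP MT; exists (Sub T MT); exact: SubK. Qed.

Lemma op_linear x : linear (op x).
Proof. by case: (factor_bounded (opP x)). Qed.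

Lemma op_vec0 x : op x 0 = 0.
Proof.
have := op_linear x 1 0 0; rewrite !scale1r addr0 => /esym/eqP.
by rewrite -subr_eq0 addrK => /eqP.
Qed.
Lemma op_vecD x u v : op x (u + v) = op x u + op x v.
Proof. by have := op_linear x 1 u v; rewrite !scale1r. Qed.
Lemma op_vecZ x a v : op x (a *: v) = a *: op x v.
Proof. by have := op_linear x a v 0; rewrite op_vec0 !addr0. Qed.

Lemma op_bounded x : exists K, bounded_by K (op x).
Proof. by case: (factor_bounded (opP x)). Qed.

Lemma opD x y v : op (x + y) v = op x v + op y v. Proof. by []. Qed.
Lemma opN x v : op (- x) v = - op x v. Proof. by []. Qed.
Lemma opZ a x v : op (a *: x) v = a *: op x v. Proof. by []. Qed.

Definition elt_one : elt := exist _ id (introT (in_factorP _) factor_id).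

Definition elt_mul (x y : elt) : elt :=
  exist _ (op x \o op y) (introT (in_factorP _) (factor_comp (opP x) (opP y))).

Lemma elt_mulA : associative elt_mul.
Proof. by move=> x y z; exact: val_inj. Qed.
Lemma elt_mul1 : left_id elt_one elt_mul.
Proof. by move=> x; exact: val_inj. Qed.
Lemma elt_mulr1 : right_id elt_one elt_mul.
Proof. by move=> x; exact: val_inj. Qed.
Lemma elt_mulDl : left_distributive elt_mul +%R.
Proof. by move=> x y z; exact: val_inj. Qed.
Lemma elt_mulDr : right_distributive elt_mul +%R.
Proof.
move=> x y z; apply: val_inj; apply/funext => v /=.
by rewrite opD op_vecD.
Qed.
Lemma elt_one_neq0 : elt_one != 0.
Proof.
have [v /eqP v0] := factor_nontrivial M; apply/eqP => /(congr1 op).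
by move=> /(congr1 (@^~ v)).
Qed.

HB.instance Definition _ := GRing.Zmodule_isNzRing.Build elt
  elt_mulA elt_mul1 elt_mulr1 elt_mulDl elt_mulDr elt_one_neq0.

Lemma op1 v : op 1 v = v. Proof. by []. Qed.
Lemma opM x y v : op (x * y) v = op x (op y v). Proof. by []. Qed.

Lemma elt_scalerAl (a : R[i]) (x y : elt) : a *: (x * y) = (a *: x) * y.
Proof. exact: val_inj. Qed.

HB.instance Definition _ :=
  GRing.Lmodule_isLalgebra.Build R[i] elt elt_scalerAl.

Lemma elt_scalerAr (a : R[i]) (x y : elt) : a *: (x * y) = x * (a *: y).
Proof.
apply: op_inj; apply/funext => v.
by rewrite opM !opZ opM op_vecZ.
Qed.

HB.instance Definition _ :=
  GRing.Lalgebra_isAlgebra.Build R[i] elt elt_scalerAr.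

Lemma elt_adjoint_exists x : exists y : elt, adjoint (op x) (op y).
Proof.
have [S MS xS] := factor_adjoint (opP x).
by have [y yS] := op_exists MS; exists y; rewrite yS.
Qed.

Definition elt_star (x : elt) : elt := projT1 (cid (elt_adjoint_exists x)).

Lemma elt_starP x : adjoint (op x) (op (elt_star x)).
Proof. by rewrite /elt_star; case: cid. Qed.

Lemma innerBl (u v w : H) : inner (u - v) w = inner u w - inner v w.
Proof. exact: linearBl. Qed.
Lemma innerBr (u v w : H) : inner u (v - w) = inner u v - inner u w.
Proof. exact: linearB. Qed.
Lemma innerZl (a : R[i]) (u v : H) : inner (a *: u) v = a * inner u v.
Proof. exact: linearZl_LR. Qed.
Lemma innerZr (a : R[i]) (u v : H) : inner u (a *: v) = Num.conj a * inner u v.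
Proof. exact: linearZ_LR. Qed.

Lemma inner_inj (u v : H) : (forall w, inner w u = inner w v) -> u = v.
Proof.
move=> uv; apply/subr0_eq/eqP; rewrite -normr_eq0 -sqrf_eq0 -innerE.
by rewrite linearB /= uv subrr.
Qed.

Lemma elt_star_unique x y : adjoint (op x) (op y) -> elt_star x = y.
Proof.
move=> xy; apply: op_inj; apply/funext => v; apply: inner_inj => w.
by rewrite -elt_starP xy.
Qed.

Lemma innerC (u v : H) : inner u v = Num.conj (inner v u).
Proof. by rewrite [LHS]hermitian_subproof expr0 mul1r. Qed.

Lemma elt_starK : involutive elt_star.
Proof.
move=> x; apply: elt_star_unique => v w.
by rewrite [RHS]innerC (elt_starP x) -innerC.
Qed.

Lemma elt_starD : {morph elt_star : x y / x + y}.
Proof.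
move=> x y; apply: elt_star_unique => v w.
by rewrite !opD linearDl linearD /= !elt_starP.
Qed.

Lemma elt_starM (x y : elt) : elt_star (x * y) = elt_star y * elt_star x.
Proof. by apply: elt_star_unique => v w; rewrite !opM !elt_starP. Qed.

Lemma elt_starZ (a : R[i]) (x : elt) :
  elt_star (a *: x) = Num.conj a *: elt_star x.
Proof.
apply: elt_star_unique => v w.
by rewrite !opZ linearZl_LR linearZ /= conjCK elt_starP.
Qed.

HB.instance Definition _ := Algebra_isStarAlgebra.Build R elt
  elt_starK elt_starD elt_starM elt_starZ.

Lemma starP (x : elt) : adjoint (op x) (op (star x)).
Proof. exact: elt_starP. Qed.

Lemma inner_star (x : elt) v w : inner (op (star x) v) w = inner v (op x w).
Proof. by rewrite starP starK. Qed.

Definition positive_elt (x : elt) := forall v, 0 <= inner (op x v) v.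

End Operators.

(* A type II_1 factor: a factor whose unit is a finite projection and which has
   no nonzero abelian projection.  It carries its tracial state [tau], which
   always exists and is unique. *)
Record II1_factor (R : realType) (H : hilbertType R) := II1Factor {
  II1_factorW :> vn_factor H;
  II1_finite : forall v : elt II1_factorW, star v * v = 1 -> v * star v = 1;
  II1_no_abelian : forall p : elt II1_factorW, abelian_projection p -> p = 0;
  tau : {scalar elt II1_factorW};
  tau_ge0 : forall x, positive_elt x -> 0 <= tau x;
  tau1 : tau 1 = 1;
  tauC : forall x y, tau (x * y) = tau (y * x)
}.
Arguments tau {R H} M : rename.

Section TwoNorm.
Variables (R : realType) (H : hilbertType R) (M : II1_factor H).
Implicit Types x y a : elt M.

Lemma positive_star_mul x : positive_elt (star x * x).
Proof. by move=> v; rewrite opM inner_star innerE exprn_ge0. Qed.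

Lemma tau_star_mul_ge0 x : 0 <= tau M (star x * x).
Proof. exact/tau_ge0/positive_star_mul. Qed.

Lemma norm2_ge0 x : 0 <= norm2 (tau M) x.
Proof. exact: sqrtr_ge0. Qed.

Lemma norm2_sqr x : (norm2 (tau M) x ^+ 2)%:C = tau M (star x * x).
Proof.
have := tau_star_mul_ge0 x; rewrite /norm2.
case: (tau M _) => a b; rewrite lecE /= => /andP[/eqP -> a0].
by rewrite sqr_sqrtr.
Qed.

Lemma star1 : star 1 = 1 :> elt M.
Proof. by rewrite -[LHS]mulr1 -[X in _ * X](starK 1) -starM mulr1 starK. Qed.

Lemma norm2_1 : norm2 (tau M) 1 = 1.
Proof. by rewrite /norm2 mulr1 star1 tau1 sqrtr1. Qed.

Lemma norm2_star x : norm2 (tau M) (star x) = norm2 (tau M) x.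
Proof. by rewrite /norm2 starK tauC. Qed.

Lemma norm2_leD x y :
  norm2 (tau M) (x + y) <= 2 * (norm2 (tau M) x + norm2 (tau M) y).
Proof.
have nx := norm2_ge0 x; have ny := norm2_ge0 y.
rewrite -(ler_pXn2r (ltn0Sn 1)) ?nnegrE ?mulr_ge0 ?addr_ge0 ?norm2_ge0//.
have : norm2 (tau M) (x + y) ^+ 2 + norm2 (tau M) (x - y) ^+ 2 =
       2 * (norm2 (tau M) x ^+ 2 + norm2 (tau M) y ^+ 2).
  apply: (@complexI R); rewrite rmorphM !rmorphD /= !norm2_sqr.
  rewrite starD starB !(mulrDl, mulrDr, mulNr, mulrN, linearD, linearN) /=.
  by ring.
have := sqr_ge0 (norm2 (tau M) (x - y)).
nra.
Qed.

Lemma bounded_op_star K x :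
  bounded_by K (op x) -> bounded_by `|K| (op (star x)).
Proof.
move=> xK v; set w := op (star x) v; set L := `|K|%:C : R[i].
have L0 : 0 <= L by rewrite lecR.
have xL u : `|op x u| <= L * `|u|.
  by apply: le_trans (xK u) _; rewrite ler_wpM2r// lecR ler_norm.
have [L_eq0|L_neq0] := eqVneq L 0.
  suff -> : w = 0 by rewrite normr0 mulr_ge0.
  apply/eqP; rewrite -normr_eq0 -sqrf_eq0 -innerE -starP.
  have : op x w = 0.
    apply/normr0_eq0/le_anti.
    by rewrite normr_ge0 andbT (le_trans (xL w))// L_eq0 mul0r.
  by move=> ->; rewrite linear0l.
have Lgt0 : 0 < L by rewrite lt_def L_neq0.
have Lr : Num.conj L = L by apply/CrealP; exact: ger0_real.
have e1 : inner (op x w) v = `|w| ^+ 2 by rewrite starP innerE.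
have e2 : inner v (op x w) = `|w| ^+ 2.
  by rewrite innerC e1 rmorphXn /= conj_Creal// normr_real.
have := exprn_ge0 2 (normr_ge0 (op x w - (L ^+ 2) *: v)).
rewrite -innerE innerBl !innerBr !innerZl !innerZr.
rewrite !innerE e1 e2 rmorphXn /= Lr.
have := xL w; rewrite -(ler_pXn2r (ltn0Sn 1)) ?nnegrE ?mulr_ge0// exprMn.
set a := `|w| ^+ 2; set b := `|op x w| ^+ 2 => ba h.
have {ba}h : 0 <= L ^+ 2 * (L ^+ 2 * `|v| ^+ 2 - a).
  apply: (le_trans h); rewrite -subr_ge0; rewrite -subr_ge0 in ba.
  apply: (le_trans ba); rewrite le_eqVlt; apply/orP; left; apply/eqP; ring.
rewrite pmulr_rge0 ?exprn_gt0// subr_ge0 in h.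
by rewrite -(ler_pXn2r (ltn0Sn 1)) ?nnegrE ?mulr_ge0// exprMn.
Qed.

Lemma norm2_leM K a x : bounded_by K (op a) ->
  norm2 (tau M) (a * x) <= `|K| * norm2 (tau M) x.
Proof.
move=> aK; rewrite -(ler_pXn2r (ltn0Sn 1)) ?nnegrE ?mulr_ge0 ?norm2_ge0//.
rewrite exprMn -lecR norm2_sqr [leRHS]rmorphM /= norm2_sqr -subr_ge0.
rewrite -scalarZ -linearB.
apply: tau_ge0 => v; rewrite starM -mulrA opD opN opZ !opM innerBl innerZl.
rewrite !inner_star !innerE subr_ge0 rmorphXn /= -exprMn.
rewrite ler_pXn2r ?nnegrE ?mulr_ge0 ?lecR//.
by apply: le_trans (aK _) _; rewrite ler_wpM2r// lecR ler_norm.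
Qed.

Lemma norm2_leMr K a x : bounded_by K (op a) ->
  norm2 (tau M) (x * a) <= `|K| * norm2 (tau M) x.
Proof.
move=> /bounded_op_star/norm2_leM.
by rewrite normr_id -norm2_star starM -(norm2_star x); exact.
Qed.

Lemma bounded_by_comp K L (x y : elt M) :
  bounded_by K (op x) -> bounded_by L (op y) ->
  bounded_by (`|K| * L) (op (x * y)).
Proof.
move=> xK yL v; rewrite opM; apply: (le_trans (xK _)).
rewrite rmorphM /= -mulrA; apply: (@le_trans _ _ (`|K|%:C * `|op y v|)).
  by rewrite ler_wpM2r// lecR ler_norm.
by rewrite ler_wpM2l// lecR.
Qed.

Lemma bounded_byD K L (x y : elt M) :
  bounded_by K (op x) -> bounded_by L (op y) -> bounded_by (K + L) (op (x + y)).
Proof.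
move=> xK yL v; rewrite opD; apply: (le_trans (ler_normD _ _)).
by rewrite rmorphD /= mulrDl lerD.
Qed.

Lemma bounded_byZ c K (x : elt M) :
  bounded_by K (op x) -> bounded_by (complex.Re `|c| * K) (op (c *: x)).
Proof.
move=> xK v; rewrite opZ normrZ rmorphM /= -mulrA.
have -> : (complex.Re `|c|)%:C = `|c| by [].
by rewrite ler_wpM2l.
Qed.

Lemma bounded_by1 : bounded_by 1 (op (1 : elt M)).
Proof. by move=> v; rewrite mul1r. Qed.

Definition bounded_seq : {pred nat -> elt M} :=
  fun x : nat -> elt M => `[< exists K, forall j, bounded_by K (op (x j)) >].

Lemma bounded_seqP (x : nat -> elt M) :
  reflect (exists K, forall j, bounded_by K (op (x j))) (x \in bounded_seq).
Proof. exact: asboolP. Qed.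

Lemma bounded_seq_submod_closed : submod_closed bounded_seq.
Proof.
split=> [|c x y /bounded_seqP[K xK] /bounded_seqP[L yL]]; apply/bounded_seqP.
  by exists 0 => j v; rewrite mul0r normr0.
by exists (complex.Re `|c| * K + L) => j; apply/bounded_byD/yL/bounded_byZ.
Qed.

Lemma bounded_seq_subring_closed : subring_closed bounded_seq.
Proof.
split=> [|x y xb yb|x y /bounded_seqP[K xK] /bounded_seqP[L yL]].
- by apply/bounded_seqP; exists 1 => j; exact: bounded_by1.
- rewrite addrC -scaleN1r; exact: bounded_seq_submod_closed.2.
- by apply/bounded_seqP; exists (`|K| * L) => j; exact: bounded_by_comp.
Qed.

HB.instance Definition _ := GRing.isSubmodClosed.Build R[i] (nat -> elt M)
  bounded_seq bounded_seq_submod_closed.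

(* The algebra of bounded sequences, with pointwise operations. *)
Definition linf := {x : nat -> elt M | x \in bounded_seq}.

HB.instance Definition _ := SubChoice.on linf.
HB.instance Definition _ := [SubChoice_isSubLmodule of linf by <:].
HB.instance Definition _ := GRing.SubZmodule_isSubNzRing.Build _ _ linf
  bounded_seq_subring_closed.

Definition seq_of (x : linf) : nat -> elt M := val x.

Lemma seq_of_bounded (x : linf) :
  exists K, forall j, bounded_by K (op (seq_of x j)).
Proof. by case: x => x xb; exact/bounded_seqP. Qed.

Lemma seq_ofD (x y : linf) j : seq_of (x + y) j = seq_of x j + seq_of y j.
Proof. by []. Qed.
Lemma seq_ofN (x : linf) j : seq_of (- x) j = - seq_of x j.
Proof. by []. Qed.
Lemma seq_ofM (x y : linf) j : seq_of (x * y) j = seq_of x j * seq_of y j.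
Proof. by []. Qed.
Lemma seq_ofZ c (x : linf) j : seq_of (c *: x) j = c *: seq_of x j.
Proof. by []. Qed.
Lemma linfP (x y : linf) : seq_of x =1 seq_of y -> x = y.
Proof. by move=> xy; apply: val_inj; apply/funext. Qed.

Lemma star_bounded_seq (x : linf) :
  (fun j => star (seq_of x j)) \in bounded_seq.
Proof.
have [K xK] := seq_of_bounded x; apply/bounded_seqP; exists `|K| => j.
exact: bounded_op_star.
Qed.

Definition linf_star (x : linf) : linf :=
  @exist (nat -> elt M) (fun y : nat -> elt M => y \in bounded_seq) _
    (star_bounded_seq x).

Lemma seq_of_star (x : linf) j : seq_of (linf_star x) j = star (seq_of x j).
Proof. by []. Qed.

Lemma seq_of1 j : seq_of 1 j = 1.
Proof. by []. Qed.

End TwoNorm.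

Record free_ultrafilter := FreeUltrafilter {
  ultra_set :> set_system nat;
  ultra_setP : UltraFilter ultra_set;
  ultra_set_free : \bigcap_(A in ultra_set) A = set0
}.
#[global] Existing Instance ultra_setP.

Section Ultrapower.
Variables (R : realType) (H : hilbertType R) (M : II1_factor H).
Variable omega : free_ultrafilter.

Definition null_seq : {pred linf M} := fun x =>
  `[< (fun j => norm2 (tau M) (seq_of x j)) @ ultra_set omega --> (0 : R) >].

Lemma null_seqP (x : linf M) : reflect
  ((fun j => norm2 (tau M) (seq_of x j)) @ ultra_set omega --> (0 : R))
  (x \in null_seq).
Proof. exact: asboolP. Qed.

Lemma null_seq_dominated (K : R) (x y : linf M) :
  x \in null_seq ->
  (forall j, norm2 (tau M) (seq_of y j) <= K * norm2 (tau M) (seq_of x j)) ->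
  y \in null_seq.
Proof.
move=> /null_seqP x0 yx; apply/null_seqP.
apply: (@squeeze_cvgr _ _ _ _ (cst 0)
  (fun j => K * norm2 (tau M) (seq_of x j))).
- by apply: nearW => j; rewrite norm2_ge0 yx.
- exact: cvg_cst.
- by rewrite -(mulr0 K); exact: (cvgM (cvg_cst _) x0).
Qed.

Lemma null_seqD x y : x \in null_seq -> y \in null_seq -> x + y \in null_seq.
Proof.
move=> /null_seqP x0 /null_seqP y0; apply/null_seqP.
apply: (@squeeze_cvgr _ _ _ _ (cst 0) (fun j =>
  2 * (norm2 (tau M) (seq_of x j) + norm2 (tau M) (seq_of y j)))).
- by apply: nearW => j; rewrite norm2_ge0 norm2_leD.
- exact: cvg_cst.
- have -> : 0 = 2 * (0 + 0) :> R by rewrite addr0 mulr0.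
  exact: (cvgM (cvg_cst _) (cvgD x0 y0)).
Qed.

Lemma null_seqMl a x : x \in null_seq -> a * x \in null_seq.
Proof.
move=> x0; have [K aK] := seq_of_bounded a.
by apply: (null_seq_dominated x0) => j; rewrite seq_ofM; exact: norm2_leM.
Qed.

Lemma null_seqMr a x : x \in null_seq -> x * a \in null_seq.
Proof.
move=> x0; have [K aK] := seq_of_bounded a.
by apply: (null_seq_dominated x0) => j; rewrite seq_ofM; exact: norm2_leMr.
Qed.

Lemma null_seqZ c x : x \in null_seq -> c *: x \in null_seq.
Proof.
have cb := bounded_byZ c (@bounded_by1 R H M) => x0.
apply: (null_seq_dominated x0) => j.
rewrite seq_ofZ -[X in _ *: X]mul1r scalerAl; exact: norm2_leM cb.
Qed.

Lemma null_seq_star x : x \in null_seq -> linf_star x \in null_seq.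
Proof.
move=> x0; apply: (@null_seq_dominated 1 x) => // j.
by rewrite mul1r norm2_star.
Qed.

Lemma null_seq1 : 1 \notin null_seq.
Proof.
apply/negP => /null_seqP; under eq_fun do rewrite norm2_1.
move=> /(cvg_lim (@norm_hausdorff _ _)); rewrite lim_cst => [/eqP|//].
by rewrite oner_eq0.
Qed.

Lemma null_seq_zmod_closed : zmod_closed null_seq.
Proof.
split=> [|x y x0 y0]; last by rewrite -scaleN1r; apply/null_seqD/null_seqZ.
rewrite -(mul0r 1); apply/null_seqP.
apply: (@cvg_trans _ ((fun=> 0) @ ultra_set omega)); last exact: cvg_cst.
apply: near_eq_cvg; apply: nearW => j.
by rewrite mul0r /norm2 mulr0 linear0 sqrtr0.
Qed.

HB.instance Definition _ := GRing.isZmodClosed.Build (linf M) null_seq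
  null_seq_zmod_closed.

(* The ideal I_omega is [null_seq], and the ultrapower is [linf M] modulo it. *)
Definition ultrapower := Quotient.quot null_seq.

HB.instance Definition _ := GRing.Zmodule.on ultrapower.
HB.instance Definition _ := EqQuotient.on ultrapower.

(* The operations are induced by those of [linf M] on representatives; they are
   well defined because [null_seq] is a two-sided ideal closed under [star]. *)
Definition ultra_one : ultrapower := lift_cst ultrapower 1.
Definition ultra_mul := lift_op2 ultrapower *%R.
Definition ultra_scale (c : R[i]) := lift_op1 ultrapower ( *:%R c).
Definition ultra_star := lift_op1 ultrapower (@linf_star R H M).

Lemma pi_eq (x y : linf M) :
  x - y \in null_seq -> \pi_ultrapower x = \pi_ultrapower y.
Proof. by move=> xy; apply/eqP; rewrite -Quotient.idealrBE. Qed.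

Lemma pi_repr (x : linf M) : repr (\pi_ultrapower x) - x \in null_seq.
Proof. by rewrite Quotient.idealrBE reprK. Qed.

Lemma pi_ultra_mul : {morph \pi_ultrapower : x y / x * y >-> ultra_mul x y}.
Proof.
move=> x y; unlock ultra_mul; apply/esym/pi_eq.
set x' := repr _; set y' := repr _.
have -> : x' * y' - x * y = (x' - x) * y' + x * (y' - y).
  by rewrite mulrBl mulrBr addrA subrK.
by apply: null_seqD; [apply: null_seqMr|apply: null_seqMl]; exact: pi_repr.
Qed.

Lemma pi_ultra_scale c :
  {morph \pi_ultrapower : x / c *: x >-> ultra_scale c x}.
Proof.
move=> x; unlock ultra_scale; apply/esym/pi_eq.
by rewrite -scalerBr; apply/null_seqZ/pi_repr.
Qed.

Lemma linf_starD : {morph @linf_star R H M : x y / x + y}.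
Proof.
by move=> x y; apply: linfP => j; rewrite !(seq_ofD, seq_of_star) starD.
Qed.

Lemma linf_starB : {morph @linf_star R H M : x y / x - y}.
Proof.
move=> x y; apply: linfP => j.
by rewrite !(seq_ofD, seq_ofN, seq_of_star) starB.
Qed.

Lemma pi_ultra_star :
  {morph \pi_ultrapower : x / linf_star x >-> ultra_star x}.
Proof.
move=> x; unlock ultra_star; apply/esym/pi_eq.
by rewrite -linf_starB; apply/null_seq_star/pi_repr.
Qed.

Lemma pi_addE (x y : linf M) :
  \pi_ultrapower (x + y) = \pi_ultrapower x + \pi_ultrapower y.
Proof. exact: Quotient.pi_add. Qed.

Lemma ultra_mulA : associative ultra_mul.
Proof.
move=> x y z; rewrite -[x]reprK -[y]reprK -[z]reprK.
by rewrite -!pi_ultra_mul mulrA.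
Qed.

Lemma ultra_oneE : ultra_one = \pi_ultrapower 1.
Proof. by unlock ultra_one. Qed.

Lemma ultra_mul1 : left_id ultra_one ultra_mul.
Proof.
by move=> x; rewrite ultra_oneE -[x]reprK -pi_ultra_mul mul1r.
Qed.

Lemma ultra_mulr1 : right_id ultra_one ultra_mul.
Proof.
by move=> x; rewrite ultra_oneE -[x]reprK -pi_ultra_mul mulr1.
Qed.

Lemma ultra_mulDl : left_distributive ultra_mul +%R.
Proof.
move=> x y z; rewrite -[x]reprK -[y]reprK -[z]reprK.
by rewrite -pi_addE -!pi_ultra_mul -pi_addE mulrDl.
Qed.

Lemma ultra_mulDr : right_distributive ultra_mul +%R.
Proof.
move=> x y z; rewrite -[x]reprK -[y]reprK -[z]reprK.
by rewrite -pi_addE -!pi_ultra_mul -pi_addE mulrDr.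
Qed.

Lemma ultra_one_neq0 : ultra_one != 0.
Proof.
rewrite ultra_oneE; have -> : 0 = \pi_ultrapower 0.
  by apply: (@addrI _ (\pi_ultrapower 0)); rewrite addr0 -pi_addE addr0.
by rewrite -Quotient.idealrBE subr0 null_seq1.
Qed.

HB.instance Definition _ := GRing.Zmodule_isNzRing.Build ultrapower
  ultra_mulA ultra_mul1 ultra_mulr1 ultra_mulDl ultra_mulDr ultra_one_neq0.

Lemma ultra_scalerA a b v :
  ultra_scale a (ultra_scale b v) = ultra_scale (a * b) v.
Proof. by rewrite -[v]reprK -!pi_ultra_scale scalerA. Qed.

Lemma ultra_scale1r : left_id 1 ultra_scale.
Proof. by move=> v; rewrite -[v]reprK -!pi_ultra_scale scale1r. Qed.

Lemma ultra_scalerDr : right_distributive ultra_scale +%R.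
Proof.
move=> a u v; rewrite -[u]reprK -[v]reprK -pi_addE -!pi_ultra_scale -pi_addE.
by rewrite scalerDr.
Qed.

Lemma ultra_scalerDl v : {morph ultra_scale^~ v : a b / a + b}.
Proof.
by move=> a b /=; rewrite -[v]reprK -!pi_ultra_scale -pi_addE scalerDl.
Qed.

HB.instance Definition _ := GRing.Zmodule_isLmodule.Build R[i] ultrapower
  ultra_scalerA ultra_scale1r ultra_scalerDr ultra_scalerDl.

Lemma pi_mulE (x y : linf M) :
  \pi_ultrapower (x * y) = \pi_ultrapower x * \pi_ultrapower y.
Proof. exact: pi_ultra_mul. Qed.

Lemma pi_oneE : \pi_ultrapower 1 = 1.
Proof. by rewrite -ultra_oneE. Qed.

Lemma pi_scaleE c (x : linf M) :
  \pi_ultrapower (c *: x) = c *: \pi_ultrapower x.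
Proof. exact: pi_ultra_scale. Qed.

Lemma ultra_scalerAl (a : R[i]) (x y : ultrapower) :
  a *: (x * y) = (a *: x) * y.
Proof.
rewrite -[x]reprK -[y]reprK -pi_mulE -!pi_scaleE -pi_mulE.
congr (\pi_ultrapower _).
by apply: linfP => j; rewrite !(seq_ofZ, seq_ofM) scalerAl.
Qed.

HB.instance Definition _ :=
  GRing.Lmodule_isLalgebra.Build R[i] ultrapower ultra_scalerAl.

Lemma ultra_scalerAr (a : R[i]) (x y : ultrapower) :
  a *: (x * y) = x * (a *: y).
Proof.
rewrite -[x]reprK -[y]reprK -pi_mulE -!pi_scaleE -pi_mulE.
congr (\pi_ultrapower _).
by apply: linfP => j; rewrite !(seq_ofZ, seq_ofM) scalerAr.
Qed.

HB.instance Definition _ :=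
  GRing.Lalgebra_isAlgebra.Build R[i] ultrapower ultra_scalerAr.

Lemma ultra_starK : involutive ultra_star.
Proof.
move=> x; rewrite -[x]reprK -!pi_ultra_star; congr (\pi_ultrapower _).
by apply: linfP => j; rewrite !seq_of_star starK.
Qed.

Lemma ultra_starD : {morph ultra_star : x y / x + y}.
Proof.
move=> x y; rewrite -[x]reprK -[y]reprK -pi_addE -!pi_ultra_star -pi_addE.
by rewrite linf_starD.
Qed.

Lemma ultra_starM (x y : ultrapower) :
  ultra_star (x * y) = ultra_star y * ultra_star x.
Proof.
rewrite -[x]reprK -[y]reprK -pi_mulE -!pi_ultra_star -pi_mulE.
congr (\pi_ultrapower _).
by apply: linfP => j; rewrite !(seq_ofM, seq_of_star) starM.
Qed.

Lemma ultra_starZ (a : R[i]) (x : ultrapower) :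
  ultra_star (a *: x) = Num.conj a *: ultra_star x.
Proof.
rewrite -[x]reprK -pi_scaleE -!pi_ultra_star -pi_scaleE.
congr (\pi_ultrapower _).
by apply: linfP => j; rewrite !(seq_ofZ, seq_of_star) starZ.
Qed.

HB.instance Definition _ := Algebra_isStarAlgebra.Build R ultrapower
  ultra_starK ultra_starD ultra_starM ultra_starZ.

(* The tracial state of the ultrapower.  Null sequences have traces tending to
   0, so the value does not depend on the representative. *)
Definition ultra_tau (x : ultrapower) : R[i] :=
  lim ((fun j => tau M (seq_of (repr x) j)) @ ultra_set omega).

End Ultrapower.

(* Main.v *)
Require Import Defs.
From mathcomp Require Import all_boot all_order all_algebra complex.
From mathcomp Require Import boolp classical_sets filter reals topology normedtype.
From mathcomp Require Import cardinality ring lra.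

(** Enumerate the countable set as [s 0, s 1, ...].  For each [n], approximate
    innerness gives a unitary [u n] of the ultrapower whose conjugation moves
    [s 0, ..., s n] to within [1 / n.+1] of their images under the automorphism.
    A unitary that is exactly right on every [s k] comes from the usual diagonal
    argument, which is the countable saturation of ultrapowers: lift [u n] to a
    sequence [w n] of elements of [M], let [d j] be the largest [n <= j] for
    which the [n.+1] requirements tested at stage [n] hold at coordinate [j] up
    to [1 / n.+1], and take the class of [j |-> w (d j) j].  As the ultrafilter
    is free, [d j] tends to infinity along it, so every single requirement is
    met in the limit ([diagonal_selection], [exact_from_approximate]).

    Being unitary is put among the requirements, in the form of the two
    equations that define it; so the entries of the [w n] may be arbitrary
    elements of [M], and only the limit has to be unitary.  The diagonal
    sequence must however be bounded in operator norm, so the lifts [w n] must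
    be bounded uniformly in [n].  This is [unitary_lift]: every unitary of the
    ultrapower has a lift bounded by 2.  Starting from any lift, a cubic map
    [x |-> x p(x^* x)] with [p(1) = 1] halves a large operator norm
    ([bounded_by_truncate]) and does not change the class, since [x^* x]
    represents 1; finitely many steps suffice.

    Distances in the ultrapower are converted to distances in [M] by
    [cvg_norm2_ultra]: the 2-norm of a class is the ultralimit of the 2-norms of
    the entries of any representative.  It rests on the Cauchy-Schwarz
    inequality [tau_le_norm2], by which null sequences have null traces. *)

Set Implicit Arguments.
Unset Strict Implicit.
Unset Printing Implicit Defensive.
Import Order.TTheory GRing.Theory Num.Theory.
Import numFieldNormedType.Exports.
Local Open Scope classical_set_scope.
Local Open Scope complex_scope.
Local Open Scope quotient_scope.
Local Open Scope ring_scope.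

(** * Reducing the operator norm by a cubic polynomial *)

Section Truncation.
Variables (R : realType) (H : hilbertType R) (M : vn_factor H).
Implicit Types x y : elt M.

Lemma conj_real (k : R) : Num.conj (k%:C : R[i]) = k%:C.
Proof. by rewrite conj_Creal// complex_real. Qed.

Lemma sqr_norm_subZ (a b : R) (v w : H) :
  `|a%:C *: v - b%:C *: w| ^+ 2 = (a ^+ 2)%:C * `|v| ^+ 2
    - (a * b)%:C * (inner v w + inner w v) + (b ^+ 2)%:C * `|w| ^+ 2.
Proof.
rewrite -!innerE innerBl !innerBr !innerZl !innerZr !conj_real.
by rewrite !rmorphM; ring.
Qed.

(** This is [x p(x^* x)] for the linear polynomial [p] of slope [- c] with
    [p 1 = 1]; it fixes every [x] with [x^* x = 1]. *)
Definition truncate (c : R) x := (1 + c)%:C *: x - c%:C *: (x * (star x * x)).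

(** For [y = truncate c x], the operator [y^* y] is the value at [x^* x] of the
    cubic [s (1 + c - c s)^2], where [0 <= s <= L] and [L = (2 K)^2 = 1 / c].
    With [t = (1 + c) / (3 c)], the critical point of this cubic,
    [4 c^2 t^3 - s (1 + c - c s)^2 = c^2 (s - t)^2 (4 t - s)],
    which is nonnegative because [L <= 4 t].  Evaluated at the operator
    [x^* x] and the vector [v], the right-hand side is
    [c^2 (4 t |w|^2 - |x w|^2)] with [w = (x^* x - t) v], which the bound on
    [x] makes nonnegative.  Finally [4 c^2 t^3 <= L / 4] as soon as
    [L >= 16]. *)
Lemma bounded_by_truncate (K : R) x : 2 <= K ->
  bounded_by (2 * K) (op x) ->
  bounded_by K (op (truncate (4 * K ^+ 2)^-1 x)).
Proof.
move=> K2 xK v; set c := _^-1.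
pose t := (1 + c) / (3 * c).
have c0 : 0 < c by rewrite invr_gt0; nra.
have cK : c * (4 * K ^+ 2) = 1 by rewrite /c mulVf//; nra.
have c16 : c <= 16^-1 by rewrite lef_pV2 ?posrE; nra.
have ct : 3 * c * t = 1 + c by rewrite /t; field; lra.
set av := op (star x * x) v.
set w : H := av - t%:C *: v.
(* [e1] comes from [1 + i x]; multiplying it by [i] makes its coefficients
   real. *)
have E1 : op (truncate c x) v = (3 * c * t)%:C *: op x v - c%:C *: op x av.
  by rewrite ct.
have [i1 i2] : inner (op x v) (op x av) = `|av| ^+ 2 /\
               inner (op x av) (op x v) = `|av| ^+ 2.
  rewrite -innerE; split; first by rewrite -inner_star -opM.
  by rewrite starP -opM.
have [i3 i4] : inner av v = `|op x v| ^+ 2 /\ inner v av = `|op x v| ^+ 2.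
  rewrite -innerE; split; first by rewrite /av opM inner_star.
  by rewrite /av opM -starP.
have xw : `|op x w| ^+ 2 <= (4 * t)%:C * `|w| ^+ 2.
  apply: (@le_trans _ _ ((2 * K)%:C ^+ 2 * `|w| ^+ 2)).
    rewrite -exprMn ler_pXn2r ?nnegrE ?mulr_ge0 ?lecR//; lra.
  rewrite ler_wpM2r ?exprn_ge0// -rmorphXn lecR.
  rewrite -(ler_pM2l c0).
  nra.
have Ew : `|w| ^+ 2 = `|av| ^+ 2 - (2 * t)%:C * `|op x v| ^+ 2
                      + (t ^+ 2)%:C * `|v| ^+ 2.
  have -> : w = 1%:C *: av - t%:C *: v by rewrite scale1r.
  rewrite sqr_norm_subZ i3 i4 !rmorphM !rmorph_nat rmorph1.
  ring.
have Exw : `|op x w| ^+ 2 = `|op x av| ^+ 2 - (2 * t)%:C * `|av| ^+ 2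
                      + (t ^+ 2)%:C * `|op x v| ^+ 2.
  have -> : op x w = 1%:C *: op x av - t%:C *: op x v.
    rewrite /w -scaleN1r addrC op_linear op_vecZ !scaleN1r.
    by rewrite addrC scale1r.
  rewrite sqr_norm_subZ i1 i2 !rmorphM !rmorph_nat rmorph1.
  ring.
(* The factorization of the cubic, evaluated at [x^* x] and paired with [v]. *)
have yE : (4 * c ^+ 2 * t ^+ 3)%:C * `|v| ^+ 2 - `|op (truncate c x) v| ^+ 2 =
   (c ^+ 2)%:C * ((4 * t)%:C * `|w| ^+ 2 - `|op x w| ^+ 2).
  rewrite E1 sqr_norm_subZ i1 i2 Ew Exw !rmorphM /=.
  ring.
rewrite -(ler_pXn2r (ltn0Sn 1)) ?nnegrE ?mulr_ge0 ?lecR//; last by lra.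
rewrite exprMn -rmorphXn.
apply: (@le_trans _ _ ((4 * c ^+ 2 * t ^+ 3)%:C * `|v| ^+ 2)).
  rewrite -subr_ge0 yE mulr_ge0 ?subr_ge0// lecR; nra.
rewrite ler_wpM2r ?exprn_ge0// lecR.
have -> : 4 * c ^+ 2 * t ^+ 3 = 4 / 27 * (1 + c) ^+ 3 / c.
  by rewrite /t; field; lra.
rewrite ler_pdivrMr//.
nra.
Qed.

End Truncation.

(** * The trace is contractive for the 2-norm *)

Section Trace.
Variables (R : realType) (H : hilbertType R) (M : II1_factor H).
Implicit Types x y : elt M.

(** A functional that is real on the elements [y^* y] is hermitian, by
    polarization with [y = 1 + x] and [y = 1 + i x]. *)
Lemma tau_star x : tau M (star x) = Num.conj (tau M x).
Proof.
have rl y : Num.conj (tau M (star y * y)) = tau M (star y * y).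
  by apply/CrealP; rewrite ger0_real// tau_star_mul_ge0.
have := rl (1 + x); have := rl (1 + 'i%C *: x).
rewrite !starD starZ star1 !mulrDl !mulrDr !mul1r !mulr1.
rewrite -!scalerAl -!scalerAr scalerA !(linearD, scalarZ, tau1) /=.
have ii : 'i%C * 'i%C = -1 :> R[i] by rewrite -expr2 sqr_i.
have ci : Num.conj 'i%C = - 'i%C :> R[i].
  by apply/eqP; rewrite eq_complex /= oppr0 !eqxx.
rewrite !(rmorphD, rmorphM, rmorph1) /= !(rl, ci) rmorphN /= ci.
set S := tau M (star x); set T := tau M x => e1 e2.
apply/subr0_eq/eqP; rewrite -(mulrI_eq0 _ (@mulfI _ 2 _)) ?pnatr_eq0//.
(* [e1] comes from [1 + i x]; multiplying it by [i] makes its coefficients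
   real. *)
have E1 : 'i%C * 'i%C * (S^* - T^* - T + S) = 0.
  move/eqP: e1; rewrite -subr_eq0 => /eqP e1.
  by rewrite -[RHS](mulr0 'i%C) -[in RHS]e1; ring.
rewrite ii mulN1r in E1.
have E2 : T^* + S^* - T - S = 0.
  by move/eqP: e2; rewrite -subr_eq0 => /eqP <-; ring.
rewrite (_ : _ * _ = - (- (S^* - T^* - T + S)) - (T^* + S^* - T - S));
  last by ring.
by rewrite E1 E2 oppr0 addr0.
Qed.

(** Cauchy-Schwarz against the unit: expand [tau (y^* y) >= 0] for
    [y = x - tau x]. *)
Lemma tau_le_norm2 x : `|tau M x| <= (norm2 (tau M) x)%:C.
Proof.
have n0 : 0 <= (norm2 (tau M) x)%:C :> R[i] by rewrite lecR norm2_ge0.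
rewrite -(ler_pXn2r (ltn0Sn 1)) ?nnegrE//.
rewrite [leRHS](_ : _ = tau M (star x * x)); last first.
  by rewrite -norm2_sqr [RHS]rmorphXn.
have := tau_star_mul_ge0 (x - tau M x *: 1).
rewrite starB starZ star1 mulrBl !mulrBr -!scalerAl -!scalerAr !mulr1 mul1r.
rewrite !linearB /= !scalarZ tau_star tau1 mulr1.
by rewrite normCK subrr addr0 subr_ge0.
Qed.

End Trace.

(** * Limits along a free ultrafilter *)

Section Limits.
Variables (R : realType) (omega : free_ultrafilter).

Lemma near_free (N : nat) : \forall j \near ultra_set omega, (N <= j)%N.
Proof.
elim: N => [|N IHN]; first exact: nearW.
have : ~ (\bigcap_(A in ultra_set omega) A) N by rewrite ultra_set_free.
move=> /existsNP[A /not_implyP[oA nAN]].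
apply: filterS2 IHN oA => j; rewrite leq_eqVlt => /predU1P[<-|//].
by move=> /nAN.
Qed.

(** Abstract diagonal argument: [G k n j] is the failure of the [n]-th candidate
    in the [k]-th requirement at coordinate [j].  If the [n]-th candidate meets
    the requirements up to [n] with tolerance [1 / n.+1] at almost every
    coordinate, all requirements are met in the limit by choosing at coordinate
    [j] the last candidate of index at most [j] that passes its own tests there.
    The index chosen tends to infinity along [omega] because [omega] is free. *)
Lemma diagonal_selection (G : nat -> nat -> nat -> R) :
  (forall n, \forall j \near ultra_set omega,
     forall k, (k <= n)%N -> G k n j < n.+1%:R^-1) ->
  exists d : nat -> nat, forall k e, 0 < e ->
    \forall j \near ultra_set omega, G k (d j) j < e.
Proof.
move=> Gn.
pose good n j := `[< forall k, (k <= n)%N -> G k n j < n.+1%:R^-1 >].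
exists (fun j => \max_(n < j.+1 | good n j) n) => k e e0.
set N := maxn k (Num.truncn e^-1).
near=> j.
have Nj : (N < j.+1)%N by rewrite ltnS; near: j; exact: near_free.
have gN : good N j by apply/asboolP; near: j; exact: Gn.
have [|n /asboolP nj nmax] := eq_bigmax_cond
  (A := [pred n : 'I_j.+1 | good n j]) (fun n => n : nat).
  by apply/card_gt0P; exists (Ordinal Nj).
rewrite nmax; have Nn : (N <= n)%N.
  by rewrite -nmax; exact: (leq_bigmax_cond (Ordinal Nj)).
apply: lt_trans (nj _ (leq_trans (leq_maxl _ _) Nn)) _.
rewrite invf_plt ?posrE//.
apply: lt_le_trans (truncnS_gt _) _.
by rewrite ler_nat ltnS (leq_trans (leq_maxr _ _) Nn).
Unshelve. all: by end_near.
Qed.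

Lemma bounded_cvg_ultra (f : nat -> R) (a b : R) :
  (forall j, a <= f j <= b) ->
  exists2 l, a <= l <= b & f @ ultra_set omega --> l.
Proof.
move=> fab.
have [|l [lab fl]] := @segment_compact R a b (f @ ultra_set omega) _.
  by apply: nearW => j; rewrite /= in_itv /= fab.
exists l => [|B lB]; first by move: lab; rewrite /= in_itv.
have [//|nB] := in_ultra_setVsetC (f @^-1` B) (ultra_setP omega).
by have [r [nrB rB]] := fl (~` B) B nB lB.
Qed.

End Limits.

Lemma gt0_complex (R : realType) (z : R[i]) :
  0 < z -> exists2 d : R, 0 < d & z = d%:C.
Proof. by case: z => d d'; rewrite ltcE /= => /andP[/eqP-> d0]; exists d. Qed.

(** * Lifting and saturation in the ultrapower *)

Section Ultrapower.
Variables (R : realType) (H : hilbertType R) (M : II1_factor H).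
Variable omega : free_ultrafilter.
Notation U := (ultrapower M omega).
Notation pi := (\pi_U).

Lemma pi_eq0 (x : linf M) : (pi x == 0) = (x \in @null_seq R H M omega).
Proof.
rewrite -[x in RHS]subr0 Quotient.idealrBE; congr (_ == _).
by apply: (@addrI _ (pi 0)); rewrite addr0 -pi_addE addr0.
Qed.

Lemma piB (x y : linf M) : pi (x - y) = pi x - pi y.
Proof. by rewrite Quotient.pi_add Quotient.pi_opp. Qed.

Lemma pi_starE (x : linf M) : pi (linf_star x) = star (pi x).
Proof. exact: pi_ultra_star. Qed.

(** The definition of [ultra_tau] uses a chosen representative [z] of
    [star (pi x) * pi x].  It differs from [star x * x] by a null sequence,
    whose traces tend to 0, and the traces of [star x * x] are the squares of
    the 2-norms of the entries of [x]. *)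
Lemma cvg_norm2_ultra (x : linf M) :
  (fun j => norm2 (tau M) (seq_of x j)) @ ultra_set omega -->
  norm2 (@ultra_tau R H M omega) (pi x).
Proof.
set n := fun j => norm2 (tau M) (seq_of x j).
have [K xK] := seq_of_bounded x.
have [|l /andP[l0 _] nl] := bounded_cvg_ultra omega
  (f := n) (a := 0) (b := `|K|).
  move=> j; apply/andP; split; first exact: norm2_ge0.
  rewrite /n -[leRHS]mulr1 -(norm2_1 M) -[seq_of x j]mulr1; exact: norm2_leM.
have n2l : (fun j => n j ^+ 2) @ ultra_set omega --> l ^+ 2 by apply: cvgM.
set z := repr (star (pi x) * pi x).
have zx : (fun j => tau M (seq_of z j)) @ ultra_set omega -->
    ((l ^+ 2)%:C : (R[i] : numFieldType)).
  have /null_seqP zx0 : z - linf_star x * x \in @null_seq R H M omega.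
    by rewrite Quotient.idealrBE /z reprK pi_mulE pi_ultra_star.
  apply/cvgrPdist_lt => d' /gt0_complex[d d0 ->].
  have d20 : 0 < d / 2 by rewrite divr_gt0.
  near=> j.
  rewrite -(subrK (tau M (star (seq_of x j) * seq_of x j)) _%:C) -addrA.
  apply: le_lt_trans (ler_normD _ _) _.
  rewrite [ltRHS](_ : _ = (d / 2)%:C + (d / 2)%:C); last first.
    by rewrite -rmorphD -splitr.
  apply: ltrD.
    rewrite -norm2_sqr -rmorphB normc_def /= expr0n addr0 sqrtr_sqr ltcR.
    near: j; exact: cvgr_dist_lt n2l _ d20.
  rewrite distrC -linearB; apply: le_lt_trans (tau_le_norm2 _) _.
  by rewrite ltcR; near: j; exact: cvgr_lt zx0 _ d20.
rewrite [X in _ --> X](_ : _ = l)//.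
rewrite /norm2 /ultra_tau -/z (cvg_lim _ zx)/=; last exact: norm_hausdorff.
by rewrite sqrtr_sqr ger0_norm.
Unshelve. all: by end_near.
Qed.

(** An arbitrary lift is bounded by some power of 2, and [truncate] halves the
    bound entry by entry while [star u * u = 1] keeps the class equal to [u]. *)
Lemma unitary_lift (u : U) : star u * u = 1 ->
  exists2 x : linf M, pi x = u & forall j, bounded_by 2 (op (seq_of x j)).
Proof.
move=> uu.
suff down n (x : linf M) : pi x = u ->
    (forall j, bounded_by (2 ^+ n.+1) (op (seq_of x j))) ->
    exists2 y : linf M, pi y = u & forall j, bounded_by 2 (op (seq_of y j)).
  have [K xK] := seq_of_bounded (repr u).
  apply: (down (Num.truncn `|K|) (repr u)) => [|j v]; first by rewrite reprK.
  apply: (le_trans (xK j v)); rewrite ler_wpM2r// lecR.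
  apply: (le_trans (ler_norm _)); apply: (le_trans (ltW (truncnS_gt _))).
  by rewrite -natrX ler_nat ltnW// ltn_expl.
elim: n x => [|n IHn] x xu xb; first by exists x => // j; rewrite -[2]expr1.
pose c : R := (4 * (2 ^+ n.+1) ^+ 2)^-1.
apply: (IHn ((1 + c)%:C *: x - c%:C *: (x * (linf_star x * x)))) => [|j].
  have -> : \pi_U ((1 + c)%:C *: x - c%:C *: (x * (linf_star x * x))) =
      (1 + c)%:C *: u - c%:C *: (u * (star u * u)).
    by rewrite piB !pi_scaleE !pi_mulE pi_starE xu.
  by rewrite uu mulr1 rmorphD scalerDl addrK scale1r.
rewrite [seq_of _ j](_ : _ = truncate c (seq_of x j))//.
apply: bounded_by_truncate; last by rewrite -exprS; exact: xb.
by rewrite exprS ler_peMr// exprn_ege1// ler1n.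
Qed.

(** These vanish in the ultrapower for all [k] exactly when the class of [w] is
    a unitary that conjugates the class of [a k] into that of [b k] for all
    [k]. *)
Definition implement_defect (a b : nat -> linf M) (k : nat) (w : linf M)
    : linf M :=
  match k with
  | 0 => linf_star w * w - 1
  | 1 => w * linf_star w - 1
  | k.+2 => b k - w * a k * linf_star w
  end.

(** The defects are computed coordinatewise, so they pass to diagonal
    sequences. *)
Lemma seq_of_implement_defect a b k (x y : linf M) j :
  seq_of x j = seq_of y j ->
  seq_of (implement_defect a b k x) j = seq_of (implement_defect a b k y) j.
Proof.
move=> xy; case: k => [|[|k]] /=.
- by rewrite !(seq_ofD, seq_ofM, seq_of_star) xy.
- by rewrite !(seq_ofD, seq_ofM, seq_of_star) xy.
- by rewrite !(seq_ofD, seq_ofN, seq_ofM, seq_of_star) xy.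
Qed.

(** Countable saturation for the system of equations [t k = Ad u (s k)], with a
    unitary unknown [u]. *)
Lemma exact_from_approximate (s t : nat -> U) :
  (forall n e, 0 < e -> exists2 u : U, Defs.is_unitary u &
     forall k, (k <= n)%N ->
       norm2 (@ultra_tau R H M omega) (t k - Ad u (s k)) < e) ->
  exists2 u : U, Defs.is_unitary u & forall k, t k = Ad u (s k).
Proof.
move=> approx; pose a k := repr (s k); pose b k := repr (t k).
have invn_gt0 n : 0 < n.+1%:R^-1 :> R by rewrite invr_gt0.
have /choice[w wP] n : exists w : linf M,
    (forall j, bounded_by 2 (op (seq_of w j))) /\
    forall k, (k <= n)%N -> \forall j \near ultra_set omega,
      norm2 (tau M) (seq_of (implement_defect a b k w) j) < n.+1%:R^-1.
  have [u [uu1 uu2] su] := approx n _ (invn_gt0 n).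
  have [w wu w2] := unitary_lift uu1; exists w; split => // k kn.
  have null x : pi x = 0 -> \forall j \near ultra_set omega,
      norm2 (tau M) (seq_of x j) < n.+1%:R^-1.
    move=> /eqP; rewrite pi_eq0 => /null_seqP x0.
    exact: cvgr_lt x0 _ (invn_gt0 n).
  case: k kn => [|[|k]] kn.
  - apply: null; rewrite /implement_defect piB pi_mulE pi_starE wu.
    by rewrite uu1 pi_oneE subrr.
  - apply: null; rewrite /implement_defect piB pi_mulE pi_starE wu.
    by rewrite uu2 pi_oneE subrr.
  - apply: (cvgr_lt _ (@cvg_norm2_ultra _)).
    rewrite piB !pi_mulE pi_starE wu !reprK.
    by apply: su; apply: leq_trans kn; rewrite -addn2 leq_addr.
have [|d dP] := diagonal_selection (omega := omega) (G := fun k n j =>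
    norm2 (tau M) (seq_of (implement_defect a b k (w n)) j)).
  move=> n.
  pose A (i : 'I_n.+1) j :=
    norm2 (tau M) (seq_of (implement_defect a b i (w n)) j) < n.+1%:R^-1.
  have : \forall j \near ultra_set omega, forall i, A i j.
    by apply: filter_forall => i; exact: ((wP n).2 i (ltn_ord i)).
  by apply: filterS => j Aj k kn; exact: (Aj (Ordinal (kn : (k < n.+1)%N))).
have W2 : (fun j => seq_of (w (d j)) j) \in @bounded_seq R H M.
  by apply/bounded_seqP; exists 2 => j; exact: (wP (d j)).1.
pose W : linf M :=
  exist (fun x : nat -> elt M => x \in @bounded_seq R H M) _ W2.
have W0 k : pi (implement_defect a b k W) = 0.
  apply/eqP; rewrite pi_eq0; apply/null_seqP/cvgrPdist_lt => e e0.
  apply: filterS (dP k e e0) => j.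
  rewrite sub0r normrN ger0_norm ?norm2_ge0//.
  by rewrite (@seq_of_implement_defect a b k W (w (d j))).
exists (pi W).
  split; rewrite -pi_oneE -pi_starE -pi_mulE; apply/subr0_eq; rewrite -piB.
    exact: (W0 0).
  exact: (W0 1).
move=> k; rewrite /Ad -[t k]reprK -[s k]reprK -pi_starE -!pi_mulE.
by apply/subr0_eq; rewrite -piB; exact: (W0 k.+2).
Qed.

End Ultrapower.

(** * Passing to countable sets *)

(** Indices outside the image of the chosen injection are sent to [x0]. *)
Lemma countable_range (T : choiceType) (x0 : T) (S : set T) :
  countable S -> exists s : nat -> T, S `<=` range s.
Proof.
move=> /countable_injP[f finj].
exists (fun n => xget x0 [set x | S x /\ f x = n]) => x Sx; exists (f x) => //.
case: xgetP => [y _ [Sy fyx]|/(_ x)]; last by case.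
by apply: finj; rewrite ?inE.
Qed.

Theorem corollary3p2 (R : realType) (H : hilbertType R) (M : II1_factor H)
  (omega : free_ultrafilter)
  (alpha : {lrmorphism ultrapower M omega -> ultrapower M omega}) :
  star_automorphism alpha ->
  approximately_inner (@ultra_tau R H M omega) alpha ->
  aleph0_locally_inner alpha.
Proof.
move=> _ alpha_approx S /(countable_range 0)[s Ss].
have [n e e0|u uu su] := exact_from_approximate (s := s) (t := alpha \o s).
  have [|u uu su] := alpha_approx [set s k | k in `I_n.+1] e _ e0.
    exact: finite_image.
  by exists u => // k kn; apply: su; exists k.
by exists u => // x /Ss[k _ <-]; exact: su.
Qed.
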